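(* For every graph $G$ (with $\bar{\kappa}(G)>0$), $\bar{\kappa}_{\max}(G)/\bar{\kappa}(G)\le 1$. Moreover this bound is asymptotically sharp: there is a sequence of graphs $G_n$ with $\bar{\kappa}_{\max}(G_n)/\bar{\kappa}(G_n)\to 1$.
   Context: Graphs are finite and simple. For a graph $G$ of order $n$ and distinct vertices $u,v$, $\kappa_G(u,v)$ is the maximum number of internally disjoint $u$--$v$ paths, and $\bar{\kappa}(G)=\binom{n}{2}^{-1}\sum_{\{u,v\}}\kappa_G(u,v)$ over unordered pairs of distinct vertices. An orientation of $G$ is obtained by directing each edge. For a digraph $D$, $\kappa_D(u,v)$ is the maximum number of internally disjoint directed $u$--$v$ paths, and $\bar{\kappa}(D)=\frac{1}{n(n-1)}\sum_{(u,v)}\kappa_D(u,v)$ over ordered pairs of distinct vertices; $\bar{\kappa}_{\max}(G)$ is the maximum of $\bar{\kappa}(D)$ over all orientations $D$ of $G$. *)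

(* Defs.v *)
From HB Require Import structures.
From mathcomp Require Import all_boot all_order all_algebra.

Set Implicit Arguments.
Unset Strict Implicit.
Unset Printing Implicit Defensive.

Import Order.TTheory GRing.Theory Num.Theory.

Record sgraph := SGraph {
  vertex :> finType;
  adj : rel vertex;
  adj_sym : symmetric adj;
  adj_irr : irreflexive adj }.

(* A path u = x_0, x_1, ..., x_k = v is represented, following path.v, by its
   start u and the tail [:: x_1; ...; x_k]. *)
Definition is_path (V : finType) (e : rel V) (u v : V) (p : seq V) : bool :=
  [&& path e u p, last u p == v & uniq (u :: p)].

Definition inner (V : finType) (u : V) (p : seq V) : seq V :=
  behead (belast u p).

(* Tails of simple paths have fewer than #|V| vertices, so the finite type
   #|V|.-bseq V contains all of them. *)
Definition int_disjoint_paths (V : finType) (e : rel V) (u v : V)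
    (P : {set #|V|.-bseq V}) : bool :=
  [forall p in P, is_path e u v p] &&
  [forall p in P, forall q in P,
     (p != q) ==> [disjoint inner u p & inner u q]].

Definition kappa (V : finType) (e : rel V) (u v : V) : nat :=
  \max_(P : {set #|V|.-bseq V} | int_disjoint_paths e u v P) #|P|.

Definition arc (V : finType) (D : {set V * V}) : rel V :=
  fun u v => (u, v) \in D.

Definition is_orientation (G : sgraph) (D : {set G * G}) : bool :=
  [forall u, forall v, (adj u v == (arc D u v || arc D v u)) &&
                       ~~ (arc D u v && arc D v u)].

Local Open Scope ring_scope.

(* Unordered pairs of distinct vertices are enumerated as the pairs (u, v) with
   u before v in enum G; by kappa_sym below the choice of order is immaterial. *)
Definition avg_kappa (R : realFieldType) (G : sgraph) : R :=
  ('C(#|G|, 2)%:R)^-1 *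
  \sum_(u : G) \sum_(v : G | (enum_rank u < enum_rank v)%N)
     (kappa (@adj G) u v)%:R.

Definition avg_dikappa (R : realFieldType) (V : finType) (D : {set V * V}) : R :=
  ((#|V| * (#|V| - 1))%N%:R)^-1 *
  \sum_(u : V) \sum_(v : V | u != v) (kappa (arc D) u v)%:R.

(* The default value 0 plays no role: see avg_kappa_max_attained and
   avg_kappa_max_ub. *)
Definition avg_kappa_max (R : realFieldType) (G : sgraph) : R :=
  \big[Num.max/0]_(D : {set G * G} | is_orientation D) avg_dikappa R D.

Lemma avg_dikappa_ge0 (R : realFieldType) (V : finType) (D : {set V * V}) :
  0 <= avg_dikappa R D.
Proof.
rewrite mulr_ge0 ?invr_ge0 ?ler0n //.
by apply: sumr_ge0 => u _; apply: sumr_ge0 => v _; rewrite ler0n.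
Qed.

Lemma avg_kappa_max_ub (R : realFieldType) (G : sgraph) (D : {set G * G}) :
  is_orientation D -> avg_dikappa R D <= avg_kappa_max R G.
Proof. by move=> oD; apply: le_bigmax_cond. Qed.

Lemma exists_orientation (G : sgraph) : exists D : {set G * G}, is_orientation D.
Proof.
exists [set x : G * G | adj x.1 x.2 && (enum_rank x.1 < enum_rank x.2)%N].
apply/forallP => u; apply/forallP => v; rewrite /arc !inE /= (adj_sym v u).
case: (boolP (adj u v)) => //= uv.
case: ltngtP => // /val_inj/enum_rank_inj uE.
by rewrite uE adj_irr in uv.
Qed.

Lemma avg_kappa_max_attained (R : realFieldType) (G : sgraph) :
  exists2 D : {set G * G},
    is_orientation D & avg_kappa_max R G = avg_dikappa R D.
Proof.
have [D0 oD0] := exists_orientation G.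
have [||D oD DE] := @eq_bigmax _ _ _ 0 D0 (@is_orientation G) (@avg_dikappa R G).
- exact: oD0.
- by move=> D _; apply: avg_dikappa_ge0.
by exists D.
Qed.

Lemma path_revK (V : finType) (e : rel V) (u v : V) (p : seq V) :
  is_path e u v p -> rev (belast v (rev (belast u p))) = p.
Proof.
case/and3P=> _ /eqP pv _; apply: (can_inj (@revK _)); rewrite revK.
case: (lastP p) pv => [|q x]; first by [].
rewrite last_rcons => ->; rewrite belast_rcons rev_rcons rev_cons.
by rewrite belast_rcons.
Qed.

Lemma is_path_rev (V : finType) (e : rel V) (u v : V) (p : seq V) :
  symmetric e -> is_path e u v p -> is_path e v u (rev (belast u p)).
Proof.
move=> se pp; case/and3P: (pp) => ep /eqP pv up; apply/and3P; split.
- by rewrite -pv rev_path; under eq_path => x y do rewrite se.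
- by rewrite -pv; case: p {pp ep pv up} => //= x p; rewrite rev_cons last_rcons.
- by rewrite -[v]pv -rev_rcons -lastI rev_uniq.
Qed.

Lemma inner_rev (V : finType) (e : rel V) (u v : V) (p : seq V) :
  is_path e u v p -> inner v (rev (belast u p)) = rev (inner u p).
Proof.
move/and3P=> [_ _ _]; rewrite /inner; case: p => //= x p.
by rewrite rev_cons belast_rcons.
Qed.

Lemma kappa_sym (V : finType) (e : rel V) (u v : V) :
  symmetric e -> kappa e u v = kappa e v u.
Proof.
move=> se; suff le x y : (kappa e x y <= kappa e y x)%N.
  by apply/eqP; rewrite eqn_leq !le.
apply/bigmax_leqP => P /andP[/'forall_implyP pP /'forall_implyP dP].
pose f (p : #|V|.-bseq V) := [bseq of rev (belast x p)].
have injf : {in P &, injective f}.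
  move=> p q Pp Pq /(congr1 val) /= pq; apply: val_inj => /=.
  by rewrite -(path_revK (pP _ Pp)) pq (path_revK (pP _ Pq)).
rewrite -(card_in_imset injf); apply: leq_bigmax_cond.
apply/andP; split; apply/'forall_implyP => _ /imsetP[p Pp ->].
  exact: is_path_rev (pP _ Pp).
apply/'forall_implyP => _ /imsetP[q Pq ->]; apply/implyP => pq.
rewrite /= (inner_rev (pP _ Pp)) (inner_rev (pP _ Pq)).
have /'forall_implyP/(_ _ Pq)/implyP := dP _ Pp.
have -> : p != q by apply: contra_neq pq => ->.
move=> /(_ isT); rewrite !disjoint_has -!all_predC => /allP d.
by apply/allP => z; rewrite mem_rev => /d /=; rewrite mem_rev.
Qed.

(* Main.v *)
Require Import Defs.
From mathcomp Require Import all_boot all_order all_algebra.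
From mathcomp Require Import all_classical all_reals all_analysis.
From mathcomp Require Import zify lra.

Import Order.TTheory GRing.Theory Num.Theory.
Import numFieldNormedType.Exports.
Local Open Scope ring_scope.

(** Every directed path of an orientation is a path of the graph, so
    [kappa_D (u, v) <= kappa_G (u, v)] for every ordered pair, whence the bound.

    For sharpness take the windmill of [m] triangles sharing a hub, each
    triangle oriented cyclically.  The orientation is strongly connected, so
    its average connectivity is at least 1.  On the other hand, deleting the
    edge [uv] (if any) leaves [u] and [v] separated by one further vertex, so
    [kappa_G (u, v) <= 1 + adj u v]; since there are only [3 m] edges against
    about [2 m ^ 2] pairs, the average connectivity of the graph tends to 1. *)

(** * Local connectivity *)

Lemma kappa_subrel (V : finType) (e e' : rel V) (u v : V) :
  subrel e e' -> (kappa e u v <= kappa e' u v)%N.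
Proof.
move=> see'; apply/bigmax_leqP => P /andP[/'forall_implyP pP dP].
apply: leq_bigmax_cond; apply/andP; split=> //.
apply/'forall_implyP => p /pP /and3P[ep pv up].
by apply/and3P; split=> //; apply: sub_path ep.
Qed.

Lemma kappa_gt0 (V : finType) (e : rel V) (u v : V) :
  connect e u v -> (0 < kappa e u v)%N.
Proof.
move=> /connectP[p ep ->]; case/shortenP: ep => q eq uq _.
(* A simple path visits at most [#|V|] vertices, so its tail fits the bounded sequences from which
   families are formed. *)
have sq : (size q <= #|V|)%N.
  by apply: leq_trans (max_card (mem (u :: q))); rewrite (card_uniqP uq) /=.
pose b := Bseq sq.
rewrite -(cards1 b); apply: leq_bigmax_cond; apply/andP; split.
  by apply/'forall_implyP => p'; rewrite inE => /eqP ->; apply/and3P; split.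
apply/'forall_implyP => p1; rewrite inE => /eqP ->.
by apply/'forall_implyP => p2; rewrite inE => /eqP ->; rewrite eqxx.
Qed.

(* The easy half of Menger's theorem, with the edge [uv] counted apart. *)
Lemma kappa_le_cut (V : finType) (e : rel V) (u v : V) (S : {set V}) :
  (forall p, is_path e u v p -> p != [:: v] -> has (mem S) (inner u p)) ->
  (kappa e u v <= e u v + #|S|)%N.
Proof.
move=> cutS; apply/bigmax_leqP => P /andP[/'forall_implyP pP /'forall_implyP dP].
(* The one-edge path has empty interior and so escapes [S]. A family, being a set, contains it at
   most once, and only if [e u v]. *)
pose direct := [set p : #|V|.-bseq V | bseqval p == [:: v]].
rewrite -(cardsID direct P) leq_add //.
  have [euv|neuv] := boolP (e u v).
    apply/card_le1_eqP => p q; rewrite !inE => /andP[_ /eqP pv] /andP[_ /eqP qv].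
    by apply: val_inj; rewrite /= pv qv.
  rewrite leqn0 cards_eq0; apply/eqP/setP => p; rewrite !inE.
  apply/negP => /andP[/pP /and3P[ep _ _] /eqP pv].
  by rewrite pv /= andbT (negPf neuv) in ep.
(* The first interior vertex of [p] lying in [S]. Distinct paths have disjoint interiors, so [f] is
   injective on the remaining paths. *)
pose f (p : #|V|.-bseq V) := nth u (inner u p) (find (mem S) (inner u p)).
have fP p : p \in P :\: direct -> f p \in S /\ f p \in inner u p.
  rewrite !inE => /andP[pv /pP pp]; have hS := cutS _ pp pv.
  by split; [exact: nth_find hS | rewrite mem_nth // -has_find].
rewrite -(@card_in_imset _ _ f); last first.
  move=> p q Dp Dq fpq; apply/eqP/negPn/negP => npq.
  have Pp : p \in P by move: Dp; rewrite inE => /andP[].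
  have Pq : q \in P by move: Dq; rewrite inE => /andP[].
  have /'forall_implyP/(_ _ Pq)/implyP/(_ npq) := dP _ Pp.
  rewrite disjoint_has => /hasP; apply; exists (f p); first by have [] := fP _ Dp.
  by rewrite fpq; have [] := fP _ Dq.
by apply/subset_leq_card/fintype.subsetP => _ /imsetP[p /fP[fS _] ->].
Qed.

(** * Averages *)

(** Symmetry of [kappa] counts each unordered pair twice. In this form the average has the
    normalisation of [avg_dikappa], and the two compare term by term. *)
Lemma avg_kappa_ordered (R : realFieldType) (G : sgraph) :
  avg_kappa R G = ((#|G| * (#|G| - 1))%N%:R)^-1 *
    \sum_(u : G) \sum_(v : G | u != v) (kappa (@adj G) u v)%:R.
Proof.
rewrite /avg_kappa; set k := kappa _.
set h := \sum_u \sum_(v | _) _.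
suff -> : \sum_u \sum_(v | u != v) (k u v)%:R = 2 * h.
  have -> : (#|G| * (#|G| - 1))%N = ('C(#|G|, 2) * 2)%N.
    by rewrite [RHS]mulnC -mul_bin_diag bin1 subn1.
  by rewrite natrM invfM -[RHS]mulrA mulKf ?pnatr_eq0.
(* The same half sum over the pairs in reverse order; the two halves together cover all ordered
   pairs. *)
have hE : h = \sum_u \sum_(v : G | (enum_rank v < enum_rank u)%N) (k u v)%:R.
  rewrite /h (exchange_big_dep xpredT) //=; apply: eq_bigr => u _.
  by apply: eq_bigr => v _; rewrite /k kappa_sym //; apply: adj_sym.
rewrite mulr_natl mulr2n {2}hE /h -big_split /=; apply: eq_bigr => u _.
rewrite (bigID (fun v => enum_rank u < enum_rank v)%N) /=.
congr (_ + _); apply: eq_bigl => v.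
  by case: eqP => //= ->; rewrite ltnn.
rewrite -leqNgt leq_eqVlt.
have -> : (enum_rank v == enum_rank u :> nat) = (u == v).
  by rewrite -[LHS]/(enum_rank v == enum_rank u) (inj_eq enum_rank_inj) eq_sym.
by case: eqVneq => //= ->; rewrite ltnn.
Qed.

Lemma avg_kappa_max_le (R : realFieldType) (G : sgraph) :
  avg_kappa_max R G <= avg_kappa R G.
Proof.
have [D oD ->] := avg_kappa_max_attained R G.
rewrite avg_kappa_ordered ler_wpM2l ?invr_ge0 ?ler0n //.
apply: ler_sum => u _; apply: ler_sum => v _; rewrite ler_nat.
apply: kappa_subrel => x y Dxy.
by move/forallP/(_ x)/forallP/(_ y)/andP: oD => [/eqP -> _]; rewrite Dxy.
Qed.

Lemma sum_distinct_pairs (R : realFieldType) (V : finType) :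
  \sum_(u : V) \sum_(v : V | u != v) (1 : R) = (#|V| * (#|V| - 1))%N%:R.
Proof.
under eq_bigr => u _.
  rewrite sumr_const.
  have -> : #|[pred v | u != v]| = (#|V| - 1)%N.
    by rewrite subn1 -(cardC1 u); apply: eq_card => v; rewrite !inE eq_sym.
  over.
by rewrite sumr_const -mulrnA mulnC.
Qed.

Lemma avg_dikappa_ge1 (R : realFieldType) (V : finType) (D : {set V * V}) :
  (1 < #|V|)%N -> (forall u v, connect (Defs.arc D) u v) ->
  1 <= avg_dikappa R D.
Proof.
move=> V2 cD; rewrite /avg_dikappa mulrC ler_pdivlMr ?ltr0n; last by lia.
rewrite mul1r -sum_distinct_pairs.
apply: ler_sum => u _; apply: ler_sum => v _.
by rewrite ler1n kappa_gt0.
Qed.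

(** * Windmill graphs *)

Section Windmill.

Variable m : nat.

(* [None] is the hub; [Some (i, b)] are the other two vertices of triangle i. *)
Definition wm_vertex : finType := option ('I_m * bool).

Definition wm_adj : rel wm_vertex := fun x y =>
  match x, y with
  | Some (i, b), Some (j, c) => (i == j) && (b != c)
  | None, None => false
  | _, _ => true
  end.

Lemma wm_adj_sym : symmetric wm_adj.
Proof. by move=> [[i b]|] [[j c]|] //=; rewrite [i == j]eq_sym [b == c]eq_sym. Qed.

Lemma wm_adj_irr : irreflexive wm_adj.
Proof. by move=> [[i b]|] //=; rewrite !eqxx. Qed.

Definition windmill : sgraph := SGraph wm_adj_sym wm_adj_irr.

Definition wm_arc : rel wm_vertex := fun x y =>
  match x, y with
  | None, Some (_, b) => ~~ b
  | Some (i, b), Some (j, c) => [&& i == j, ~~ b & c]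
  | Some (_, b), None => b
  | None, None => false
  end.

Definition wm_orient : {set windmill * windmill} :=
  [set x | wm_arc x.1 x.2].

Lemma wm_orientP : is_orientation wm_orient.
Proof.
apply/forallP => u; apply/forallP => v; rewrite /Defs.arc !inE /=.
case: u v => [[i b]|] [[j c]|] //=; [|by case: b|by case: c].
by rewrite [j == i]eq_sym; case: (i == j); case: b; case: c.
Qed.

Lemma wm_orient_connect (u v : windmill) : connect (Defs.arc wm_orient) u v.
Proof.
have arcE x y : wm_arc x y -> connect (Defs.arc wm_orient) x y.
  by move=> a; apply: connect1; rewrite /Defs.arc inE.
apply: (@connect_trans _ _ None).
  case: u => [[i []]|]; [exact: arcE | | exact: connect0].
  apply: (@connect_trans _ _ (Some (i, true))); apply: arcE => //=.
  by rewrite eqxx.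
case: v => [[i []]|]; [ | exact: arcE | exact: connect0].
apply: (@connect_trans _ _ (Some (i, false))); apply: arcE => //=.
by rewrite eqxx.
Qed.

Lemma card_windmill : #|windmill| = (2 * m).+1.
Proof. by rewrite card_option card_prod card_ord card_bool mulnC. Qed.

(** For [u] off the hub, one vertex meets every path with at least two edges: the hub if [v] is not
    the hub, and the partner of [u] in its triangle otherwise. *)
Lemma windmill_kappa_le (u v : windmill) :
  u != v -> (kappa (@adj windmill) u v <= (adj u v).+1)%N.
Proof.
(* At most one of [u] and [v] is the hub, and [kappa] is symmetric. *)
wlog [i [b ->]] : u v / exists i b, u = Some (i, b).
  move=> wl; case: u => [[i b]|]; first by apply: wl; exists i, b.
  case: v => [[i b]|] // _; rewrite kappa_sym; last exact: adj_sym.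
  by apply: (wl (Some (i, b)) None) => //; exists i, b.
move=> uv; pose s : windmill := if v is Some _ then None else Some (i, ~~ b).
rewrite -addn1 -(cards1 s); apply: kappa_le_cut => -[|y [|z p]].
- by case/and3P=> _ /= /eqP uE; rewrite uE eqxx in uv.
- by case/and3P=> _ /= /eqP ->; rewrite eqxx.
case/and3P=> /= /and3P[uy yz _] /eqP pv /and3P[nu ny _] _.
have yv : y != v.
  by apply: contraNneq ny => ->; rewrite -pv mem_last.
rewrite /inner /= inE.
case: v @s uv pv yv => [[j c]|] /= uv pv yv.
  case: y uy yz nu ny yv => [[k d]|] //= /andP[/eqP <- bd] yz nu ny yv.
  (* Here [y] is the partner of [u], whose only neighbours are [u] and the hub; a simple path cannot
     return to [u]. *)
  have zE : z = None.
    case: z yz pv nu {ny} => [[k' d']|] //= /andP[/eqP <- dd'] _.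
    by case: b d d' bd dd' {uv yv} => [] [] [] // _ _; rewrite !inE !eqxx ?orbT.
  by rewrite zE in pv *; case: p pv {nu ny} => //= w p _; rewrite inE eqxx ?orbT.
case: y uy yv {yz nu ny} => [[k d]|] //= /andP[/eqP <- bd] _.
by case: b d bd {uv} => [] [] //=; rewrite eqxx.
Qed.

Lemma wm_sum (F : windmill -> nat) :
  (\sum_u F u = F None + \sum_i (F (Some (i, false)) + F (Some (i, true))))%N.
Proof.
rewrite (bigD1 None) //= (reindex_omap Some id) /=; last by case.
congr (_ + _)%N; under eq_bigl => x do rewrite eqxx.
have -> : (\sum_(x : 'I_m * bool) F (Some x) =
    \sum_(x : 'I_m * bool) F (Some (x.1, x.2)))%N by apply: eq_bigr => -[].
rewrite -(pair_bigA _ (fun i b => F (Some (i, b)))) /=.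
by apply: eq_bigr => i _; rewrite big_bool addnC.
Qed.

(** Degree sum: the hub has degree [2 * m], and each of the [2 * m] other vertices has degree 2. *)
Lemma sum_wm_adj : (\sum_(u : windmill) \sum_(v : windmill) adj u v = 6 * m)%N.
Proof.
have deg i b : (\sum_(v : windmill) @adj windmill (Some (i, b)) v = 2)%N.
  rewrite wm_sum /= (bigD1 i) //= eqxx big1 => [|j ji]; first by case: b.
  by rewrite eq_sym (negPf ji).
rewrite wm_sum wm_sum /=; under [X in (_ + X)%N]eq_bigr => i _ do rewrite !deg.
by rewrite !sum_nat_const card_ord; lia.
Qed.

(** The excess over 1 is at most the density of adjacent ordered pairs, [6 * m] out of
    [(2 * m + 1) * (2 * m)]. *)
Lemma avg_kappa_windmill_le (R : realFieldType) :
  (0 < m)%N -> avg_kappa R windmill <= 1 + 3 / (2 * m).+1%:R.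
Proof.
move=> m0; rewrite avg_kappa_ordered mulrC.
have N0 : (0 < #|windmill| * (#|windmill| - 1))%N by rewrite card_windmill; lia.
rewrite ler_pdivrMr ?ltr0n //.
apply: (@le_trans _ _ (\sum_(u : windmill) (\sum_(v : windmill | u != v) 1 +
                        \sum_(v : windmill) (adj u v)%:R))).
  apply: ler_sum => u _; rewrite [leRHS]addrC.
  rewrite [X in X + _](bigID (fun v => u != v)) /= addrAC -big_split /=.
  rewrite ler_wpDr ?sumr_ge0 //; apply: ler_sum => v uv.
  by rewrite natr1 ler_nat windmill_kappa_le.
rewrite big_split /= sum_distinct_pairs.
under [X in _ + X]eq_bigr => u _ do rewrite -natr_sum.
rewrite -natr_sum sum_wm_adj card_windmill subn1 /= mulrDl mul1r lerD2l.
rewrite [X in _ * X]natrM mulrA divfK ?pnatr_eq0 // -natrM ler_nat.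
by rewrite mulnA.
Qed.

Lemma avg_kappa_max_windmill_ge1 (R : realFieldType) :
  (0 < m)%N -> 1 <= avg_kappa_max R windmill.
Proof.
move=> m0; apply: le_trans (avg_kappa_max_ub R wm_orientP).
apply: avg_dikappa_ge1 wm_orient_connect.
by rewrite card_windmill; lia.
Qed.

End Windmill.

Local Open Scope classical_set_scope.

Theorem theorem2p4 (R : realType) :
  (forall G : sgraph,
     0 < avg_kappa R G -> avg_kappa_max R G / avg_kappa R G <= 1) /\
  (exists G : nat -> sgraph,
     (forall n, 0 < avg_kappa R (G n)) /\
     ((fun n => avg_kappa_max R (G n) / avg_kappa R (G n)) @ \oo --> (1 : R))).
Proof.
have bound G : 0 < avg_kappa R G -> avg_kappa_max R G / avg_kappa R G <= 1.
  by move=> G0; rewrite ler_pdivrMr // mul1r avg_kappa_max_le.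
(* The shift guarantees a triangle: [windmill 0] is a single vertex, with average 0. *)
split=> //; exists (fun n => windmill n.+1).
have max1 n : 1 <= avg_kappa_max R (windmill n.+1).
  exact: avg_kappa_max_windmill_ge1.
have pos n : 0 < avg_kappa R (windmill n.+1).
  by apply: lt_le_trans (avg_kappa_max_le R _); apply: lt_le_trans (max1 n).
split=> //.
apply: (@squeeze_cvgr _ _ _ _ (fun n => 1 - 3 * @harmonic R n) (cst 1)).
- apply: nearW => n; rewrite bound // andbT.
  have := @avg_kappa_windmill_le n.+1 R isT.
  set k := avg_kappa R _; set M := avg_kappa_max R _ => kle.
  rewrite ler_pdivlMr ?pos // /harmonic /=.
  have hle : (2 * n.+1).+1%:R^-1 <= n.+1%:R^-1 :> R.
    by rewrite lef_pV2 ?posrE ?ltr0n // ler_nat; lia.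
  have k1 : 1 <= k := le_trans (max1 n) (avg_kappa_max_le R _).
  have M1 : 1 <= M := max1 n.
  (* The only nonlinear input. With [h = 1 / (n + 1)] it gives [(1 - 3 * h) * k <= k - 3 * h], which
     is at most 1 by [kle] and [hle], hence at most [M]. *)
  have hk : 0 <= n.+1%:R^-1 * (k - 1) by rewrite mulr_ge0 ?subr_ge0 ?invr_ge0.
  move: kle hle hk; move: (_.+1%:R^-1) (_.+1%:R^-1) => h h' kle hle hk.
  rewrite mulrBr mulr1 in hk; rewrite mulrBl mul1r -mulrA; lra.
- rewrite -[X in _ --> X]subr0 -[X in _ - X](mulr0 3).
  by apply: cvgB; [exact: cvg_cst | apply: cvgMr; exact: cvg_harmonic].
- exact: cvg_cst.
Qed.
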